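(* Let $X$ be a normed vector space over $\mathbb{R}$ (not necessarily complete), let $X^*$ be the space of bounded linear functionals $\phi\colon X\to\mathbb{R}$, and let $S$ be a subset of $X$. If $\phi(S)$ is a bounded subset of $\mathbb{R}$ for each $\phi\in X^*$, then $S$ is bounded in $X$. In fact, if $S$ is unbounded, then there exist $\phi\in X^*$ and a sequence $(s_n)$ in $S$ satisfying $\|s_{n+1}\|_X>\|s_n\|_X$ and $|\phi(s_{n+1})|>|\phi(s_n)|$ for all $n$, and $|\phi(s_n)|\to\infty$ as $n\to\infty$.
   Context: All vector spaces are over $\mathbb{R}$ and all linear maps are real-linear. A linear functional $\phi\colon X\to\mathbb{R}$ is bounded if $\sup_{\|x\|_X\le 1}|\phi(x)|<\infty$. A subset $S\subseteq X$ is bounded if $\sup_{s\in S}\|s\|_X<\infty$, and unbounded otherwise. *)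

(* Defs.v *)
From mathcomp Require Import all_boot all_order all_algebra.
From mathcomp Require Import all_classical all_reals topology normedtype.

Set Implicit Arguments.
Unset Strict Implicit.
Unset Printing Implicit Defensive.

Import Order.TTheory GRing.Theory Num.Theory.
Import numFieldNormedType.Exports.

Local Open Scope classical_set_scope.
Local Open Scope ring_scope.

(* The underlying set of X^*: the finiteness of the supremum of |phi| over the
   closed unit ball is the library's [bounded _ | _ in _]. *)
Definition dual (R : realType) (X : normedModType R) :
    set {linear X -> R^o} :=
  [set phi | [bounded phi x | x in [set x : X | `|x| <= 1]]].

Arguments dual {R} X.

(* Main.v *)
(* Linear functionals are the minimal sublinear ones, so by Zorn every sublinear
   function dominates a linear functional; this gives Hahn-Banach.

   For unbounded S take s_n in S with |s_n| > n 3^(n+1), and starting from 0 let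
   psi_(n+1) = psi_n +- 2 3^-(n+1) f_n, where |f_n| <= 1, f_n(s_n) = |s_n|,
   and the sign makes |psi_(n+1)(s_n)| >= 2 3^-(n+1) |s_n|. The sublinear
   functions psi_n + 3^-n |.| decrease with n, hence their infimum is sublinear
   and dominates some linear phi. Then |phi - psi_n| <= 3^-n |.| for all n, so
   |phi(s_n)| >= 3^-(n+1) |s_n| > n, and neither the completeness of X^* nor
   Baire's theorem is needed. *)
Require Import Defs.
From HB Require Import structures.
From mathcomp Require Import all_boot all_order all_algebra.
From mathcomp Require Import all_classical all_reals topology normedtype.
From mathcomp Require Import lra.

Import Order.TTheory GRing.Theory Num.Theory.
Import numFieldNormedType.Exports.

Local Open Scope classical_set_scope.
Local Open Scope ring_scope.

(** Homogeneity is stated as an inequality, which passes easily to infima; equality for [t > 0]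
    follows by scaling back with [t^-1]. *)
Definition sublinear {R : realType} {V : lmodType R} (p : V -> R) :=
  (forall x y, p (x + y) <= p x + p y) /\
  (forall t x, 0 <= t -> p (t *: x) <= t * p x).

Lemma sublinear0 {R : realType} {V : lmodType R} {p : V -> R} :
  sublinear p -> p 0 = 0.
Proof.
move=> [pD pZ]; have := pD 0 0; have := pZ 0 0 (lexx _).
rewrite scale0r addr0; lra.
Qed.

Lemma sublinearZ {R : realType} {V : lmodType R} {p : V -> R} (t : R) (x : V) :
  sublinear p -> 0 <= t -> p (t *: x) = t * p x.
Proof.
move=> sp; rewrite le_eqVlt => /predU1P[<-|t0].
  by rewrite scale0r mul0r sublinear0.
apply/eqP; rewrite eq_le; apply/andP; split; first exact: sp.2 (ltW t0).
have := sp.2 t^-1 (t *: x); rewrite invr_ge0 ltW// => /(_ isT).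
by rewrite scalerA mulVf ?gt_eqF// scale1r ler_pdivlMl.
Qed.

Lemma sublinear_opp_le {R : realType} {V : lmodType R} {p : V -> R} (x : V) :
  sublinear p -> - p (- x) <= p x.
Proof.
by move=> sp; have := sp.1 x (- x); rewrite subrr (sublinear0 sp); lra.
Qed.

(** The bound [b] keeps the infima finite. The index [k] may depend on the points, which covers
    tilts, chains and decreasing sequences alike. *)
Lemma sublinear_inf {R : realType} {V : lmodType R} {I : Type} (i0 : I)
    (g : I -> V -> R) (b : V -> R) :
    (forall i x, b x <= g i x) ->
    (forall i j x y, exists k, g k (x + y) <= g i x + g j y) ->
    (forall i t x, 0 <= t -> exists k, g k (t *: x) <= t * g i x) ->
  exists2 q, sublinear q & forall i x, q x <= g i x.
Proof.
move=> bg gD gZ; pose q x := inf (range (g^~ x)).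
have qg i x : q x <= g i x.
  apply: ge_inf; last by exists i.
  by exists (b x) => _ [j _ <-].
have le_q x m : (forall i, m <= g i x) -> m <= q x.
  move=> mg; apply: lb_le_inf; first by exists (g i0 x), i0.
  by move=> _ [j _ <-].
exists q => //; split=> [x y|t x].
  rewrite -lerBlDl; apply: (le_q) => j; rewrite lerBlDl -lerBlDr.
  apply: (le_q) => i; rewrite lerBlDr.
  by have [k] := gD i j x y; apply: le_trans.
rewrite le_eqVlt => /predU1P[<-|t0].
  have [k] := gZ i0 0 x (lexx _); rewrite !mul0r; exact: le_trans.
rewrite -ler_pdivrMl//; apply: (le_q) => i; rewrite ler_pdivrMl//.
by have [k] := gZ i t x (ltW t0); apply: le_trans.
Qed.

(* [q] is the infimum over [t >= 0] of [p (x + t y) - t p y]. For minimal [p] it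
   equals [p], whence additivity; for [p] the norm, [q (- y) <= - `|y|] makes
   every linear functional below [q] norming at [y]. *)
Lemma sublinear_tilt {R : realType} {V : lmodType R} {p : V -> R} (y : V) :
    sublinear p ->
  exists2 q, sublinear q &
    forall t x, 0 <= t -> q x <= p (x + t *: y) - t * p y.
Proof.
move=> sp.
have [|||q sq qle] := sublinear_inf (exist (fun t : R => 0 <= t) 0 (lexx 0))
  (fun t x => p (x + sval t *: y) - sval t * p y) (fun x => - p (- x)).
(* Lower bound: [t * p y = p (t *: y) <= p (x + t *: y) + p (- x)]. *)
- move=> [t t0] x /=; have := sp.1 (x + t *: y) (- x).
  by rewrite addrC addKr (sublinearZ _ _ sp t0); lra.
- move=> [t t0] [u u0] x z; exists (exist _ (t + u) (addr_ge0 t0 u0)) => /=.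
  have := sp.1 (x + t *: y) (z + u *: y).
  by rewrite addrACA -scalerDl mulrDl; lra.
- move=> [t t0] u x u0; exists (exist _ (u * t) (mulr_ge0 u0 t0)) => /=.
  have := sp.2 u (x + t *: y) u0.
  by rewrite scalerDr scalerA mulrBr mulrA; lra.
by exists q => // t x t0; have := qle (exist _ t t0) x.
Qed.

Lemma minimal_sublinear_linear {R : realType} {V : lmodType R} {p : V -> R} :
    sublinear p ->
    (forall q, sublinear q -> (forall x, q x <= p x) ->
      forall x, p x <= q x) ->
  exists phi : {linear V -> R^o}, forall x, phi x = p x.
Proof.
move=> sp pmin.
have pD x y : p (x + y) = p x + p y.
  apply/eqP; rewrite eq_le sp.1/=.
  (* Taking [t = 0] gives [q <= p], so [p <= q] by minimality; [t = 1] then gives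
     [p x <= q x <= p (x + y) - p y]. *)
  have [q sq qle] := sublinear_tilt y sp.
  have := qle 1 x ler01; rewrite scale1r mul1r => q1.
  rewrite -lerBrDr; apply: le_trans q1; apply: pmin => // z.
  by have := qle 0 z (lexx _); rewrite scale0r addr0 mul0r subr0.
have pN x : p (- x) = - p x.
  by have := pD x (- x); rewrite subrr sublinear0//; lra.
have plin : GRing.linear_for *:%R (p : V -> R^o).
  move=> t x y; rewrite pD; congr (_ + _).
  have [t0|/ltW t0] := leP 0 t; first exact: sublinearZ.
  rewrite -[t]opprK scaleNr pN sublinearZ ?oppr_ge0//.
  by rewrite /GRing.scale/= mulNr !opprK.
pose L := GRing.isLinear.Build R V R^o *:%R (p : V -> R^o) plin.
pose phi : {linear V -> R^o} := HB.pack (p : V -> R^o) L.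
by exists phi.
Qed.

Lemma sublinear_dominates_linear {R : realType} {V : lmodType R} {p : V -> R} :
  sublinear p -> exists phi : {linear V -> R^o}, forall x, phi x <= p x.
Proof.
move=> sp; pose T := {q : V -> R | sublinear q /\ forall x, q x <= p x}.
pose p0 : T := exist _ p (conj sp (fun x => lexx (p x))).
(* The order is reversed, so that the maximal element from Zorn is a minimal sublinear function. *)
pose ge (q r : T) := `[< forall x, sval r x <= sval q x >].
have [||A totA|[q [sq qp]] qmin] := @ZL_preorder T p0 ge.
- by move=> q; apply/asboolP.
- move=> r s t /asboolP rs /asboolP st; apply/asboolP => x.
  exact: le_trans (st x) (rs x).
- have [[a Aa]|A0] := pselect (A !=set0); last first.
    by exists p0 => s As; case: A0; exists s.
  have [|||q sq qle] := sublinear_inf (exist A a Aa)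
    (fun a => sval (sval a)) (fun x => - p (- x)).
  + move=> [[r [sr rp]] _] x /=; apply: le_trans (sublinear_opp_le _ sr).
    by rewrite lerN2.
  + move=> [r Ar] [s As] x y /=.
    (* The smaller of the two members of the chain serves as the index for the sum. *)
    have [/asboolP rs|/asboolP sr] := totA _ _ Ar As.
      exists (exist _ s As) => /=; apply: le_trans ((svalP s).1.1 _ _) _.
      by rewrite lerD2r.
    exists (exist _ r Ar) => /=; apply: le_trans ((svalP r).1.1 _ _) _.
    by rewrite lerD2l.
  + by move=> [r Ar] t x t0; exists (exist _ r Ar); apply: (svalP r).1.2.
  have qp x : q x <= p x.
    exact: le_trans (qle (exist _ a Aa) x) ((svalP a).2 x).
  exists (exist _ q (conj sq qp)) => s As; apply/asboolP => x /=.
  exact: (qle (exist _ s As)).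
have [r sr rq x|phi phiE] := minimal_sublinear_linear sq.
  have rp z : r z <= p z := le_trans (rq z) (qp z).
  have /asboolP := qmin (exist _ r (conj sr rp)) (asboolT rq); exact.
by exists phi => x; rewrite phiE.
Qed.

Lemma sublinear_norm {R : realType} {X : normedModType R} :
  sublinear (fun x : X => `|x|).
Proof.
by split=> [x y|t x t0]; rewrite ?ler_normD// normrZ ger0_norm.
Qed.

Lemma norming_functional {R : realType} {X : normedModType R} (y : X) :
  exists2 phi : {linear X -> R^o}, (forall x, `|phi x| <= `|x|) & phi y = `|y|.
Proof.
have [q sq qle] := sublinear_tilt y sublinear_norm.
have [phi phiq] := sublinear_dominates_linear sq.
have phile x : phi x <= `|x|.
  apply: le_trans (phiq x) _; have := qle 0 x (lexx _).
  by rewrite scale0r addr0 mul0r subr0.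
exists phi => [x|].
  rewrite ler_norml phile andbT lerNl.
  by have := phile (- x); rewrite raddfN normrN.
apply/eqP; rewrite eq_le phile/=.
have := le_trans (phiq (- y)) (qle 1 (- y) ler01).
by rewrite scale1r addNr normr0 mul1r raddfN; lra.
Qed.

(** A multiple of a norming functional is added with the sign of [psi s], so that the two terms
    cannot cancel at [s]. *)
Lemma functional_perturbation {R : realType} {X : normedModType R}
    (psi : {linear X -> R^o}) (s : X) (c : R) :
    0 <= c ->
  exists psi' : {linear X -> R^o},
    (forall x, `|psi' x - psi x| <= c * `|x|) /\ c * `|s| <= `|psi' s|.
Proof.
move=> c0; have [phi phile phis] := norming_functional s.
have cphi x : `|c * phi x| <= c * `|x|.
  by rewrite normrM (ger0_norm c0) ler_wpM2l.
have [psis0|psis0] := leP 0 (psi s : R).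
  exists (psi \+ (c \*: phi)); split=> [x|] /=.
    by rewrite addrC addKr; apply: cphi.
  by rewrite phis; apply: le_trans (ler_norm _); rewrite /GRing.scale/= lerDr.
exists (psi \- (c \*: phi)); split=> [x|] /=.
  by rewrite addrC addKr normrN; apply: cphi.
rewrite phis /GRing.scale/= -[leRHS]normrN opprB; apply: le_trans (ler_norm _).
by rewrite lerDl oppr_ge0 ltW.
Qed.

Lemma unbounded_set_gt {R : realType} {X : normedModType R} {S : set X} (M : R) :
  ~ bounded_set S -> exists2 s, S s & M < `|s|.
Proof.
move=> Sunb; apply: contrapT => nS; apply: Sunb.
apply: filterS (nbhs_pinfty_ge (num_real M)) => N MN s Ss /=.
apply: le_trans MN; rewrite leNgt; apply/negP => Ms.
by apply: nS; exists s.
Qed.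

Lemma functional_unbounded {R : realType} {X : normedModType R} {S : set X} :
    ~ bounded_set S ->
  exists phi : {linear X -> R^o}, (forall x, `|phi x| <= `|x|) /\
    forall M, exists2 s, S s & M < `|phi s : R|.
Proof.
move=> Sunb; pose e n : R := 3^-1 ^+ n.
have e0 n : 0 < e n by rewrite exprn_gt0// invr_gt0 ltr0n.
have eS n : e n = 3 * e n.+1 by rewrite /e exprS mulrA divff ?mul1r// pnatr_eq0.
have /choice[s sP] n : exists s, S s /\ n%:R / e n.+1 < `|s|.
  by have [s] := unbounded_set_gt (n%:R / e n.+1) Sunb; exists s.
(* Choosing [F] for every pair of index and functional lets [psi] be defined by plain recursion. *)
have /choice[F FP] (nf : nat * {linear X -> R^o}) :=
  functional_perturbation nf.2 (s nf.1) _
    (mulr_ge0 (ler0n R 2) (ltW (e0 nf.1.+1))).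
pose psi := nat_rect (fun=> {linear X -> R^o}) (\0 : {linear X -> R^o})
  (fun n f => F (n, f)).
pose p n x : R := psi n x + e n * `|x|.
have pS n x : p n.+1 x <= p n x.
  (* The step from [psi n] costs at most [2 * e n.+1] times the norm, and
     [2 * e n.+1 + e n.+1 = e n]. *)
  have := (FP (n, psi n)).1 x; rewrite /p/= ler_norml => /andP[_].
  by rewrite (eS n); lra.
have p_le m n x : (m <= n)%N -> p n x <= p m x.
  by move=> /subnK <-; elim: (n - m)%N => // k; apply: le_trans; apply: pS.
have [|||q sq qp] := sublinear_inf 0%N p (fun x => - `|x|).
(* Here [- |x| = - p 0 (- x) <= - p n (- x) <= p n x]. *)
- move=> n x; suff : - p n (- x) <= p n x.
    by have := p_le 0%N n (- x) (leq0n _); rewrite {2}/p/= /e expr0 normrN; lra.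
  have := mulr_ge0 (ltW (e0 n)) (normr_ge0 x).
  by rewrite /p raddfN normrN; lra.
- move=> m n x y; exists (maxn m n).
  have := p_le _ _ x (leq_maxl m n); have := p_le _ _ y (leq_maxr m n).
  have := ler_wpM2l (ltW (e0 (maxn m n))) (ler_normD x y).
  by rewrite /p raddfD mulrDr/=; lra.
- move=> n t x t0; exists n.
  by rewrite /p linearZ normrZ (ger0_norm t0)/= /GRing.scale/= mulrDr mulrCA.
have [phi phiq] := sublinear_dominates_linear sq.
have phip n x : phi x - psi n x <= e n * `|x|.
  by have := le_trans (phiq x) (qp n x); rewrite /p; lra.
have dist n x : `|phi x - psi n x| <= e n * `|x|.
  rewrite ler_norml phip andbT.
  by have := phip n (- x); rewrite !raddfN/= normrN; lra.
exists phi; split=> [x|M].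
  by have := dist 0%N x; rewrite /= subr0 /e expr0 mul1r.
have [Ss ns] := sP (Num.trunc M).+1.
exists (s (Num.trunc M).+1) => //.
set n := (Num.trunc M).+1 in Ss ns *.
apply: lt_le_trans (truncnS_gt M) _.
move: ns; rewrite ltr_pdivrMr// => /ltW/le_trans; apply.
(* Stage [n] secures [2 * e n.+1 * |s n|], and passing from [psi n.+1] to [phi] loses at most
   [e n.+1 * |s n|]. *)
have := dist n.+1 (s n); have := (FP (n, psi n)).2.
have := lerB_dist (psi n.+1 (s n) : R) (phi (s n)).
by rewrite [`|psi n.+1 _ - _|]distrC /=; lra.
Qed.

Theorem theorem2 (R : realType) (X : normedModType R) (S : set X) :
  ((forall phi : {linear X -> R^o}, dual X phi -> bounded_set (phi @` S)) ->
    bounded_set S)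
  /\
  (~ bounded_set S ->
    exists (phi : {linear X -> R^o}) (s : nat -> X),
      [/\ dual X phi,
          (forall n, S (s n)),
          (forall n, `|s n.+1| > `|s n|),
          (forall n, `|phi (s n.+1)| > `|phi (s n)|) &
          `|phi (s n)| @[n --> \oo] --> +oo]).
Proof.
have dual_le1 (phi : {linear X -> R^o}) :
    (forall x, `|phi x| <= `|x|) -> dual X phi.
  move=> phile; apply: filterS (nbhs_pinfty_ge (num_real 1)) => M M1 x /= x1.
  exact: le_trans (phile x) (le_trans x1 M1).
split=> [bS|Sunb].
  apply: contrapT => /functional_unbounded[phi [phile phiS]].
  have [M _ bM] := pinfty_ex_gt (num_real 0) (bS phi (dual_le1 _ phile)).
  have [s Ss] := phiS M; apply/negP; rewrite -leNgt.
  by apply: bM; exists s.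
have [phi [phile phiS]] := functional_unbounded Sunb.
(* Since [|phi z| <= |z|] for all [z], this single inequality makes both the norms and the values
   [|phi|] increase by more than 1 along the sequence. The subtype carries membership in [S]. *)
have next (x : {x | S x}) :
    {y : {x | S x} | `|sval x| + 1 < `|phi (sval y) : R|}.
  by apply: cid; have [y Sy] := phiS (`|sval x| + 1); exists (exist _ y Sy).
have [s0 Ss0 _] := phiS 0.
have [u [_ uS]] := dependent_choice next (exist _ s0 Ss0).
exists phi, (fun n => sval (u n)); split.
- exact: dual_le1.
- by move=> n; apply: svalP.
- by move=> n; have := uS n; have := phile (sval (u n.+1)); lra.
- by move=> n; have := uS n; have := phile (sval (u n)); lra.
apply/cvgryPge => A.
have un n : n%:R <= `|phi (sval (u n)) : R|.
  elim: n => [|n IH]; first exact: normr_ge0.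
  by have := uS n; have := phile (sval (u n)); rewrite -natr1; lra.
exists (Num.trunc A).+1 => // n /= An; apply: le_trans (un n).
by rewrite (le_trans (ltW (truncnS_gt A)))// ler_nat.
Qed.
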